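(* Let $N,T\ge 2$ and let $\mathbf{Y}$ be an $N\times T$ real matrix for which only the $(N,T)$ entry is missing, with observed index set $\mathcal{O}=([N]\times[T])\setminus\{(N,T)\}$. Write $$\mathbf{Y}=\begin{pmatrix}\mathbf{Y}_0&\mathbf{y}_1\\ \mathbf{y}_2^\top&?\end{pmatrix},\qquad \mathbf{Y}_0\in\mathbb{R}^{(N-1)\times(T-1)},\ \mathbf{y}_1\in\mathbb{R}^{N-1},\ \mathbf{y}_2\in\mathbb{R}^{T-1}.$$ For an integer $R\ge 0$, $\mathbf{A}\in\mathbb{R}^{N\times R}$, $\mathbf{B}\in\mathbb{R}^{T\times R}$, $\gamma\in\mathbb{R}^N$, $\delta\in\mathbb{R}^T$, let $$Q(\mathbf{Y};R,\mathbf{A},\mathbf{B},\gamma,\delta)=\frac{1}{|\mathcal{O}|}\left\|\mathbf{P}_{\mathcal{O}}\left(\mathbf{Y}-\mathbf{A}\mathbf{B}^\top-\gamma\mathbf{1}_T^\top-\mathbf{1}_N\delta^\top\right)\right\|_F^2 .$$ Then each of the estimators below (defined in the context) is obtained by minimizing $Q$ under restrictions or with regularization, in the following sense. (i) (nuclear norm matrix completion) Let $\lambda>0$. The set of triples $(\mathbf{A}\mathbf{B}^\top,\gamma,\delta)$, as $(R,\mathbf{A},\mathbf{B},\gamma,\delta)$ ranges over the minimizers of $$Q(\mathbf{Y};R,\mathbf{A},\mathbf{B},\gamma,\delta)+\frac{\lambda}{2}\|\mathbf{A}\|_F^2+\frac{\lambda}{2}\|\mathbf{B}\|_F^2$$ over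 $R\in\{0,1,\dots,\min(N,T)\}$, $\mathbf{A}\in\mathbb{R}^{N\times R}$, $\mathbf{B}\in\mathbb{R}^{T\times R}$, $\gamma\in\mathbb{R}^N$, $\delta\in\mathbb{R}^T$, equals the set of nuclear norm matrix completion solutions $(\hat{\mathbf{L}},\hat\Gamma,\hat\Delta)$ with penalty $\lambda$. In (ii)–(vi), the set of imputed values $(\mathbf{A}\mathbf{B}^\top+\gamma\mathbf{1}_T^\top+\mathbf{1}_N\delta^\top)_{NT}$, as $(R,\mathbf{A},\mathbf{B},\gamma,\delta)$ ranges over the minimizers of the stated objective subject to the stated constraints, equals the set of values imputed for entry $(N,T)$ by the named estimator: (ii) (horizontal regression, for $N>T$) minimize $Q(\mathbf{Y};R,\mathbf{A},\mathbf{B},\gamma,\delta)$ subject to $$R=T-1,\quad \mathbf{A}=\begin{pmatrix}\mathbf{Y}_0\\ \mathbf{y}_2^\top\end{pmatrix},\quad \gamma=0,\quad \delta_1=\delta_2=\cdots=\delta_{T-1}=0;$$ (iii) (vertical regression, for $T>N$) minimize $Q(\mathbf{Y};R,\mathbf{A},\mathbf{B},\gamma,\delta)$ subject to $$R=N-1,\quad \mathbf{B}=\begin{pmatrix}\mathbf{Y}_0^\top\\ \mathbf{y}_1^\top\end{pmatrix},\quad \gamma_1=\gamma_2=\cdots=\gamma_{N-1}=0,\quad \delta=0;$$ (iv) (synthetic control) minimize $Q(\mathbf{Y};R,\mathbf{A},\mathbf{B},\gamma,\delta)$ subject to $$R=N-1,\quad \mathbf{B}=\begin{pmatrix}\mathbf{Y}_0^\top\\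 \mathbf{y}_1^\top\end{pmatrix},\quad \delta=0,\quad \gamma=0,\quad A_{Ni}\ge 0\ \text{ for all } i\in[N-1],\quad \sum_{i=1}^{N-1}A_{Ni}=1;$$ (v) (vertical regression, elastic net, with $\lambda\ge 0$, $\alpha\in[0,1]$) minimize $$Q(\mathbf{Y};R,\mathbf{A},\mathbf{B},\gamma,\delta)+\lambda\left[\frac{1-\alpha}{2}\left\|\begin{pmatrix}\mathbf{a}_2\\ \mathbf{a}_3\end{pmatrix}\right\|_F^2+\alpha\left\|\begin{pmatrix}\mathbf{a}_2\\ \mathbf{a}_3\end{pmatrix}\right\|_1\right]$$ subject to $$R=N-1,\quad \mathbf{B}=\begin{pmatrix}\mathbf{Y}_0^\top\\ \mathbf{y}_1^\top\end{pmatrix},\quad \gamma_1=\gamma_2=\cdots=\gamma_{N-1}=0,\quad \delta=0,$$ where $\mathbf{A}$ is partitioned as $\mathbf{A}=\begin{pmatrix}\tilde{\mathbf{A}}&\mathbf{a}_1\\ \mathbf{a}_2^\top&\mathbf{a}_3\end{pmatrix}$, so that $(\mathbf{a}_2^\top,\mathbf{a}_3)$ is the last row of $\mathbf{A}$; (vi) (difference-in-differences) minimize $Q(\mathbf{Y};R,\mathbf{A},\mathbf{B},\gamma,\delta)$ subject to $R=0$.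
   Context: Notation: $[n]=\{1,\dots,n\}$; $\mathbf{1}_n$ is the all-ones vector in $\mathbb{R}^n$; $\mathbf{P}_{\mathcal{O}}(\mathbf{M})$ is the matrix that agrees with $\mathbf{M}$ on entries in $\mathcal{O}$ and is $0$ elsewhere (so the missing entry of $\mathbf{Y}$ is irrelevant); $\|\cdot\|_F$ is the Frobenius norm; $\|\cdot\|_*$ is the nuclear norm (sum of singular values); $\|\cdot\|_1$ of a vector is the sum of absolute values of its entries. When $R=0$, $\mathbf{A}\mathbf{B}^\top$ is the $N\times T$ zero matrix. In (ii)–(vi), parameters not constrained are free. Estimators, for the case where only entry $(N,T)$ is missing: Nuclear norm matrix completion with penalty $\lambda$: the solutions are the minimizers $(\hat{\mathbf{L}},\hat\Gamma,\hat\Delta)$ over $\mathbf{L}\in\mathbb{R}^{N\times T}$, $\Gamma\in\mathbb{R}^N$, $\Delta\in\mathbb{R}^T$ of $\frac{1}{|\mathcal{O}|}\|\mathbf{P}_{\mathcal{O}}(\mathbf{Y}-\mathbf{L}-\Gamma\mathbf{1}_T^\top-\mathbf{1}_N\Delta^\top)\|_F^2+\lambda\|\mathbf{L}\|_*$. Horizontal regression: the imputed value is $\hat\beta_0+\sum_{s=1}^{T-1}\hat\beta_sY_{Ns}$, with $\hat\beta$ a minimizer of $\sum_{i=1}^{N-1}(Y_{iT}-\beta_0-\sum_{s=1}^{T-1}\beta_sY_{is})^2$. Vertical regression: the imputed value is $\hat\gamma_0+\sum_{i=1}^{N-1}\hat\gamma_iY_{iT}$, with $\hat\gamma$ a minimizer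 of $\sum_{t=1}^{T-1}(Y_{Nt}-\gamma_0-\sum_{i=1}^{N-1}\gamma_iY_{it})^2$. Synthetic control (Abadie–Diamond–Hainmueller): same as the vertical regression but with intercept $\gamma_0=0$, $\gamma_i\ge 0$ for all $i\in[N-1]$ and $\sum_{i=1}^{N-1}\gamma_i=1$. Vertical regression with elastic net (parameters $\lambda,\alpha$): the imputed value is $\hat\gamma_0+\sum_{i=1}^{N-1}\hat\gamma_iY_{iT}$, with $\hat\gamma$ a minimizer of $\frac{1}{|\mathcal{O}|}\sum_{t=1}^{T-1}(Y_{Nt}-\gamma_0-\sum_{i=1}^{N-1}\gamma_iY_{it})^2+\lambda\left[\frac{1-\alpha}{2}\sum_{i=1}^{N-1}\gamma_i^2+\alpha\sum_{i=1}^{N-1}|\gamma_i|\right]$. Difference-in-differences: the imputed value is $\hat\gamma_N+\hat\delta_T$, with $(\hat\gamma,\hat\delta)\in\mathbb{R}^N\times\mathbb{R}^T$ a minimizer of $\sum_{(i,t)\in\mathcal{O}}(Y_{it}-\gamma_i-\delta_t)^2$ (regression on unit and time fixed effects). *)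

(* Defs.v *)
From HB Require Import structures.
From mathcomp Require Export all_boot all_order all_algebra.
From mathcomp Require Export boolp classical_sets reals.
From mathcomp Require Export polyrcf.
Set Implicit Arguments.
Unset Strict Implicit.
Unset Printing Implicit Defensive.
Import Order.TTheory GRing.Theory Num.Theory.
Local Open Scope classical_set_scope.
Local Open Scope ring_scope.

(* Throughout, N = n + 1 and T = m + 1, so that N x T matrices can be cut into
   blocks by [block_mx], [col_mx], [dsubmx] and [lshift]. *)

Definition argmin (R : realType) (X : Type) (C : set X) (f : X -> R) : set X :=
  [set x | C x /\ forall y, C y -> f x <= f y].

(* The 1-based index N of [N], as the ordinal n of 'I_(n + 1). *)
Definition last_ord (n : nat) : 'I_(n + 1) := rshift n ord0.

Definition ones (R : realType) (n : nat) : 'cV[R]_n := const_mx 1.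

Section Norms.
Variable R : realType.

Definition frob (m n : nat) (M : 'M[R]_(m, n)) : R :=
  Num.sqrt (\sum_i \sum_j M i j ^+ 2).

Definition l1norm (n : nat) (v : 'cV[R]_n) : R := \sum_i `|v i 0|.

(* Square roots of the eigenvalues of M^T M, listed with their multiplicity as
   roots of the characteristic polynomial.  [M^T *m M] is n x n, so when m < n
   the list also contains (at least) n - m zeros. *)
Definition singular_values (m n : nat) (M : 'M[R]_(m, n)) : seq R :=
  let p := char_poly (M^T *m M) in
  flatten [seq nseq (mup x p) (Num.sqrt x) | x <- rootsR p].

Definition nuclear_norm (m n : nat) (M : 'M[R]_(m, n)) : R :=
  \sum_(s <- singular_values M) s.

End Norms.

Definition observed (n m : nat) : {set 'I_(n + 1) * 'I_(m + 1)} :=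
  (~: [set (last_ord n, last_ord m)])%SET.

Definition proj (R : realType) (N T : nat) (O : {set 'I_N * 'I_T})
    (M : 'M[R]_(N, T)) : 'M[R]_(N, T) :=
  \matrix_(i, t) if (i, t) \in O then M i t else 0.

(* A parameter tuple (R, A, B, gamma, delta), with the rank R varying. *)
Record factors (R : realType) (N T : nat) := Factors {
  frank : nat;
  fA : 'M[R]_(N, frank);
  fB : 'M[R]_(T, frank);
  fgamma : 'cV[R]_N;
  fdelta : 'cV[R]_T }.

Section Estimators.
Variables (R : realType) (n m : nat).
Local Notation N := (n + 1)%N.
Local Notation T := (m + 1)%N.
Local Notation iN := (last_ord n).
Local Notation iT := (last_ord m).
Local Notation O := (observed n m).

Definition twoway (L : 'M[R]_(N, T)) (gamma : 'cV[R]_N) (delta : 'cV[R]_T) :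
    'M[R]_(N, T) :=
  L + gamma *m (ones R T)^T + ones R N *m delta^T.

Definition Q (Y : 'M[R]_(N, T)) (p : factors R N T) : R :=
  #|O|%:R^-1 *
    frob (proj O (Y - fA p *m (fB p)^T - fgamma p *m (ones R T)^T
                    - ones R N *m (fdelta p)^T)) ^+ 2.

Definition imputed (p : factors R N T) : R :=
  twoway (fA p *m (fB p)^T) (fgamma p) (fdelta p) iN iT.

(* The transpose of the last row of A, i.e. the column (a_2 ; a_3). *)
Definition last_row (p : factors R N T) : 'cV[R]_(frank p) := (dsubmx (fA p))^T.

(* The estimators below never read the entry (N, T) of [Y]. *)

Definition nuclear_norm_mc (lambda : R) (Y : 'M[R]_(N, T)) :
    set ('M[R]_(N, T) * 'cV[R]_N * 'cV[R]_T) :=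
  argmin setT (fun '(L, Gamma, Delta) =>
    #|O|%:R^-1 *
      frob (proj O (Y - L - Gamma *m (ones R T)^T - ones R N *m Delta^T)) ^+ 2
    + lambda * nuclear_norm L).

(* [beta.1] is the intercept beta_0 and [beta.2] the vector of slopes;
   likewise for the vertical regressions. *)
Definition horizontal_regression (Y : 'M[R]_(N, T)) : set R :=
  [set beta.1 + \sum_(s < m) beta.2 s 0 * Y iN (lshift 1 s) | beta in
    argmin setT (fun beta : R * 'cV[R]_m =>
      \sum_(i < n) (Y (lshift 1 i) iT - beta.1
        - \sum_(s < m) beta.2 s 0 * Y (lshift 1 i) (lshift 1 s)) ^+ 2)].

Definition vertical_sse (Y : 'M[R]_(N, T)) (gamma : R * 'cV[R]_n) : R :=
  \sum_(t < m) (Y iN (lshift 1 t) - gamma.1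
    - \sum_(i < n) gamma.2 i 0 * Y (lshift 1 i) (lshift 1 t)) ^+ 2.

Definition vertical_imputed (Y : 'M[R]_(N, T)) (gamma : R * 'cV[R]_n) : R :=
  gamma.1 + \sum_(i < n) gamma.2 i 0 * Y (lshift 1 i) iT.

Definition vertical_regression (Y : 'M[R]_(N, T)) : set R :=
  vertical_imputed Y @` argmin setT (vertical_sse Y).

Definition synthetic_control (Y : 'M[R]_(N, T)) : set R :=
  vertical_imputed Y @`
    argmin [set gamma : R * 'cV[R]_n |
             [/\ gamma.1 = 0, forall i, 0 <= gamma.2 i 0
               & \sum_(i < n) gamma.2 i 0 = 1]]
           (vertical_sse Y).

Definition elastic_net (lambda alpha : R) (Y : 'M[R]_(N, T)) : set R :=
  vertical_imputed Y @`
    argmin setT (fun gamma : R * 'cV[R]_n =>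
      #|O|%:R^-1 * vertical_sse Y gamma
      + lambda * ((1 - alpha) / 2%:R * (\sum_(i < n) gamma.2 i 0 ^+ 2)
                  + alpha * (\sum_(i < n) `|gamma.2 i 0|))).

Definition difference_in_differences (Y : 'M[R]_(N, T)) : set R :=
  [set gd.1 iN 0 + gd.2 iT 0 | gd in
    argmin setT (fun gd : 'cV[R]_N * 'cV[R]_T =>
      \sum_(it in O) (Y it.1 it.2 - gd.1 it.1 0 - gd.2 it.2 0) ^+ 2)].

End Estimators.

(* Main.v *)
Require Import Defs.
From mathcomp Require Import all_boot all_order all_algebra.
From mathcomp Require Import boolp classical_sets reals polyrcf.
From mathcomp Require Import complex ring.
Set Implicit Arguments.
Unset Strict Implicit.
Unset Printing Implicit Defensive.
Import Order.TTheory GRing.Theory Num.Theory.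
Local Open Scope classical_set_scope.
Local Open Scope ring_scope.

(* Two argmin problems have the same image as soon as every feasible point of
   one can be matched by a feasible point of the other with the same image and
   an objective that is no larger (up to a common positive factor).

   For (i), the match comes from the variational formula: the nuclear norm of L
   is the minimum of (|A|_F^2 + |B|_F^2) / 2 over the factorizations L = A B^T.
   If L = U^T S V is a compact singular value decomposition, then
   A = U^T S^(1/2) and B = V^T S^(1/2) attain it; conversely the sum of the
   singular values of A B^T is the trace of (U A) (V B)^T, which Cauchy-Schwarz
   and Bessel bound by (|A|_F^2 + |B|_F^2) / 2.

   For (ii)-(v), the fixed factor contains the observed columns (or rows) of Y,
   so that an identity block in the free factor makes all the residuals vanish
   except those of the column (or row) with the missing entry, which are the
   residuals of the regression. *)

(** * Orthogonal diagonalization of real symmetric matrices *)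

(** Over the complex numbers [S] is Hermitian, so the spectral theorem gives a real eigenvalue. It
    is then a root of the characteristic polynomial of [S] itself, which yields an eigenvector with
    real entries. *)
Lemma symmetric_eigenvector (R : rcfType) n (S : 'M[R]_n.+1) : S^T = S ->
  exists (a : R) (v : 'rV[R]_n.+1), v != 0 /\ v *m S = a *: v.
Proof.
move=> Ssym; pose Sc := map_mx (real_complex R) S.
have Sc_real : Sc \is a realmx.
  by apply/mxOverP => i j; rewrite mxE; apply/complex_realP; exists (S i j).
have Sc_herm : Sc \is hermsymmx.
  apply: realsym_hermsym => //; apply/is_hermitianmxP.
  rewrite expr0 scale1r map_mx_id //; apply/matrixP => i j.
  by rewrite !mxE -[in LHS]Ssym mxE.
have /mxOverP/(_ 0 0)/complex_realP[a eq_a] :=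
  hermitian_spectral_diag_real Sc_herm.
have /hermitian_normalmx/orthomx_spectralP := Sc_herm.
move/(congr1 (mulmx (spectralmx Sc))).
rewrite !mulmxA mulmxV ?spectral_unit // mul1mx => /(congr1 (row 0)) eq_row.
have : eigenvalue Sc a%:C%C.
  apply/eigenvalueP; exists (row 0 (spectralmx Sc)).
    by rewrite -row_mul eq_row row_mul row_diag_mx -scalemxAl -rowE eq_a.
  rewrite rowE; apply/eqP => /(congr1 (mulmx^~ (invmx (spectralmx Sc)))).
  rewrite mulmxK ?spectral_unit // mul0mx => /matrixP/(_ 0 0)/eqP.
  by rewrite !mxE !eqxx oner_eq0.
rewrite eigenvalue_root_char -map_char_poly fmorph_root -eigenvalue_root_char.
by case/eigenvalueP => v vS v0; exists a, v.
Qed.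

Lemma mulmx_tr_rowE (R : comNzRingType) n (u v : 'rV[R]_n) :
  (u *m v^T) 0 0 = \sum_i u 0 i * v 0 i.
Proof. by rewrite mxE; apply: eq_bigr => i _; rewrite mxE. Qed.

(* The Householder reflection in the bisector of [v] and [e_0]. *)
Lemma orthogonal_row0 (R : rcfType) n (v : 'rV[R]_n.+1) : v != 0 ->
  exists (H : 'M[R]_n.+1) (c : R), H *m H^T = 1%:M /\ row 0 H = c *: v.
Proof.
move=> v0; pose e : 'rV[R]_n.+1 := delta_mx 0 0.
pose s := (v *m v^T) 0 0; pose c := Num.sqrt s.
have s_gt0 : 0 < s.
  rewrite /s mulmx_tr_rowE lt0r sumr_ge0 ?andbT; last first.
    by move=> i _; rewrite -expr2 sqr_ge0.
  apply: contra v0 => /eqP/psumr_eq0P sum0; apply/eqP/rowP => i.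
  rewrite mxE; apply/eqP; rewrite -sqrf_eq0 expr2 sum0 // => j _.
  by rewrite -expr2 sqr_ge0.
have c_gt0 : 0 < c by rewrite sqrtr_gt0.
have c0 : c != 0 by rewrite gt_eqF.
have cc : s = c ^+ 2 by rewrite sqr_sqrtr // ltW.
pose w := v - c *: e.
(* Here [c] is the length of [v]. If [v 0 0 = c], then [v] is already [c *: e], the reflection
   degenerates ([w = 0]), and the identity serves as [H]. *)
have [w0|w_neq0] := eqVneq (v 0 0) c.
  exists 1%:M, c^-1; rewrite trmx1 mulmx1; split=> //.
  have : v = c *: e.
    apply/rowP => i; rewrite !mxE eqxx /=.
    case: (eqVneq i 0) => [->|i0]; first by rewrite mulr1.
    move: cc; rewrite /s mulmx_tr_rowE (bigD1 0) //= w0 -expr2.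
    move/(canRL (addKr _)); rewrite addNr => sum0; rewrite mulr0.
    apply/eqP; rewrite -sqrf_eq0 expr2; apply/eqP.
    by apply: (psumr_eq0P _ sum0) => // j _; rewrite -expr2 sqr_ge0.
  by move=> ->; rewrite scalerA mulVf // scale1r row1.
have ee : e *m e^T = 1%:M.
  by apply/matrixP=> i j; rewrite trmx_delta mul_delta_mx !ord1 !mxE.
have ve : v *m e^T = (v 0 0)%:M.
  by apply/matrixP=> i j; rewrite !ord1 trmx_delta -colE !mxE.
have ev : e *m v^T = (v 0 0)%:M.
  by apply/matrixP=> i j; rewrite !ord1 -rowE !mxE.
have vv : v *m v^T = (c ^+ 2)%:M.
  by rewrite -cc; apply/matrixP=> i j; rewrite !ord1 [RHS]mxE eqxx mulr1n.
(* [q] is the squared length of [w], and [1 - (2 / q) w^T w] is the reflection that exchanges [e]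
   with the unit vector [v / c]. *)
pose q := 2 * c * (c - v 0 0).
have q0 : q != 0.
  by rewrite !mulf_neq0 ?pnatr_eq0 // subr_eq0 eq_sym.
have wT : w^T = v^T - c *: e^T by rewrite linearB linearZ.
have ww : w *m w^T = q%:M.
  rewrite wT /w mulmxBl !mulmxBr -!scalemxAl -!scalemxAr.
  rewrite ee ve ev vv scalerA; apply/matrixP => i j; rewrite !ord1 !mxE /=.
  by rewrite /q; ring.
have ew : e *m w^T = (v 0 0 - c)%:M.
  rewrite wT mulmxBr -!scalemxAr.
  by rewrite ee ev scalemx1 -raddfB.
pose P := w^T *m w.
have PP : P *m P = q *: P.
  by rewrite /P mulmxA -(mulmxA _ w) ww mul_mx_scalar -scalemxAl.
have PT : P^T = P by rewrite /P trmx_mul trmxK.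
exists (1%:M - (2 / q) *: P), c^-1; split.
  have -> : (1%:M - (2 / q) *: P)^T = 1%:M - (2 / q) *: P.
    by rewrite linearB linearZ /= trmx1 PT.
  rewrite mulmxBl !mulmxBr !mulmx1 mul1mx.
  rewrite -scalemxAl -scalemxAr PP !scalerA.
  have -> : 2 / q * (2 / q) * q = 2 / q + 2 / q by field.
  by rewrite scalerDl opprB addrK subrK.
rewrite rowE mulmxBr mulmx1 -scalemxAr /P mulmxA ew mul_scalar_mx scalerA.
have -> : 2 / q * (v 0 0 - c) = - c^-1.
  rewrite /q; field; rewrite c0 subr_eq0 eq_sym //.
by rewrite scaleNr opprK /w scalerBr scalerA mulVf // scale1r addrC subrK.
Qed.

(** Deflation: conjugating by an orthogonal matrix whose first row is a multiple of an eigenvector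
    splits off a 1 x 1 block, and the remaining block is symmetric of smaller size. *)
Lemma symmetric_diagonalization (R : rcfType) n (S : 'M[R]_n) : S^T = S ->
  exists (U : 'M[R]_n) (d : 'rV[R]_n),
    U *m U^T = 1%:M /\ U *m S *m U^T = diag_mx d.
Proof.
elim: n S => [|n IHn] S Ssym.
  by exists 1%:M, 0; split; apply/matrixP => -[].
have [a [v [v0 vS]]] := symmetric_eigenvector Ssym.
have [H [c [HH rowH]]] := orthogonal_row0 v0.
(* The existential keeps [S'] opaque and types its size as [1 + n], the form that the block
   submatrices expect. *)
have [S' defS'] : exists S' : 'M[R]_(1 + n), S' = H *m S *m H^T.
  by exists (H *m S *m H^T).
have S'sym : S'^T = S' by rewrite defS' !trmx_mul trmxK Ssym mulmxA.
have rowS' : row 0 S' = a *: delta_mx 0 0.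
  rewrite defS' !row_mul rowH -scalemxAl vS scalerA mulrC -scalerA -rowH.
  by rewrite -scalemxAl -row_mul HH row1.
have ur0 : ursubmx S' = 0.
  apply/matrixP => i j; rewrite ord1 !mxE; move/rowP/(_ (rshift 1 j)): rowS'.
  rewrite !mxE eqxx /= mulr0 => <-; congr (S' _ _); exact: val_inj.
have ul : ulsubmx S' = a%:M.
  apply/matrixP => i j; rewrite !ord1 !mxE; move/rowP/(_ 0): rowS'.
  rewrite !mxE !eqxx /= mulr1 => <-; congr (S' _ _); exact: val_inj.
have dl0 : dlsubmx S' = 0 by rewrite -[S']S'sym -trmx_ursub ur0 trmx0.
have drsym : (drsubmx S')^T = drsubmx S' by rewrite trmx_drsub S'sym.
have [U [d [UU Ud]]] := IHn _ drsym.
pose V : 'M[R]_(1 + n) := block_mx 1%:M 0 0 U.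
have VT : V^T = block_mx 1%:M 0 0 U^T by rewrite tr_block_mx trmx1 !trmx0.
have VV : V *m V^T = 1%:M.
  rewrite VT mulmx_block !mulmx0 !mul0mx !addr0 add0r mulmx1 UU.
  by rewrite -scalar_mx_block.
have VS'V : V *m S' *m V^T = diag_mx (row_mx a%:M d).
  rewrite -[S']submxK ul ur0 dl0 VT !mulmx_block.
  rewrite !(mulmx0, mul0mx, addr0, add0r) mulmx1 mul1mx Ud.
  rewrite diag_mx_row; congr block_mx.
  by apply/matrixP => i j; rewrite !ord1 !mxE.
exists ((V : 'M_n.+1) *m H), (row_mx a%:M d : 'rV_(1 + n)); split.
  by rewrite trmx_mul mulmxA -(mulmxA (V : 'M_n.+1)) HH mulmx1.
by rewrite -VS'V defS' trmx_mul !mulmxA.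
Qed.

(** * Singular values and the compact singular value decomposition *)

Lemma char_poly_conj (R : comNzRingType) n (U V A : 'M[R]_n) : U *m V = 1%:M ->
  char_poly (U *m A *m V) = char_poly A.
Proof.
move=> UV; pose c := map_mx (@polyC R).
have cUV : c _ _ U *m c _ _ V = 1%:M by rewrite -map_mxM UV map_mx1.
rewrite /char_poly; transitivity (\det (c _ _ U *m char_poly_mx A *m c _ _ V)).
  congr (\det _); rewrite /char_poly_mx mulmxBr mulmxBl !map_mxM.
  by rewrite mul_mx_scalar -scalemxAl cUV scalemx1.
by rewrite !det_mulmx mulrC mulrA -det_mulmx (mulmx1C cUV) det1 mul1r.
Qed.

(** [singular_values] lists distinct roots repeated by multiplicity. For a split polynomial this is
    the sequence of its linear factors up to order, since the multiplicity of a root is its number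
    of occurrences in [s]. *)
Lemma sum_rootsR_mup (R : rcfType) (s : seq R) (f : R -> R) :
  let p := \prod_(x <- s) ('X - x%:P) in
  \sum_(y <- flatten [seq nseq (mup x p) (f x) | x <- rootsR p]) y
  = \sum_(x <- s) f x.
Proof.
move=> p; have p0 : p != 0 by rewrite monic_neq0 // monic_prod_XsubC.
rewrite big_flatten big_map.
under eq_bigr => x _ do rewrite big_nseq -Monoid.iteropE mu_prod_XsubC.
rewrite -[RHS]big_undup_iterop_count.
  apply: perm_big; apply: uniq_perm; rewrite ?undup_uniq ?uniq_roots //.
  move=> x; rewrite mem_undup.
  by rewrite -(roots_on_rootsR p0) in_itv /p root_prod_XsubC.
Qed.

Lemma nuclear_norm_diag (R : realType) p n (M : 'M[R]_(p, n)) (W : 'M[R]_n) d :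
  W *m W^T = 1%:M -> W *m (M^T *m M) *m W^T = diag_mx d ->
  nuclear_norm M = \sum_i Num.sqrt (d 0 i).
Proof.
move=> WW Wd; rewrite /nuclear_norm /singular_values.
have -> : char_poly (M^T *m M) =
    \prod_(x <- [seq d 0 i | i <- index_enum 'I_n]) ('X - x%:P).
  rewrite -(char_poly_conj _ WW) Wd char_poly_trig ?diag_mx_is_trig // big_map.
  by apply: eq_bigr => i _; rewrite mxE eqxx mulr1n.
by rewrite sum_rootsR_mup big_map.
Qed.

(** This supplies the bound [R <= min(N, T)] for the factorizations in (i). *)
Lemma leq_orthonormal_rows (F : fieldType) r n (U : 'M[F]_(r, n)) :
  U *m U^T = 1%:M -> (r <= n)%N.
Proof.
move=> UU; have /eqP <- : row_free U by apply/row_freeP; exists U^T.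
exact: rank_leq_col.
Qed.

(** If [W] diagonalizes [M^T M], the columns of [X = M W^T] are orthogonal with squared lengths [d].
    The nonzero columns, normalized, become the rows of [U]; the matching rows of [W] form [V]. *)
Lemma compact_svd (R : realType) p n (M : 'M[R]_(p, n)) :
  exists r (U : 'M[R]_(r, p)) (V : 'M[R]_(r, n)) (s : 'rV[R]_r),
    [/\ forall i, 0 <= s 0 i, U *m U^T = 1%:M, V *m V^T = 1%:M,
        M = U^T *m diag_mx s *m V & nuclear_norm M = \sum_i s 0 i].
Proof.
have [|W [d [WW Wd]]] := @symmetric_diagonalization R n (M^T *m M).
  by rewrite trmx_mul trmxK.
have [X defX] : exists X, X = M *m W^T by exists (M *m W^T).
have XX : X^T *m X = diag_mx d by rewrite -Wd defX trmx_mul trmxK !mulmxA.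
have XXE i j : \sum_a X a i * X a j = d 0 i *+ (i == j).
  have /matrixP/(_ i j) := XX; rewrite !mxE => <-.
  by apply: eq_bigr => a _; rewrite mxE.
have dE i : d 0 i = \sum_a X a i ^+ 2.
  by have := XXE i i; rewrite eqxx mulr1n => <-; apply: eq_bigr.
have d_ge0 i : 0 <= d 0 i by rewrite dE sumr_ge0 // => a _; rewrite sqr_ge0.
have X0 i a : d 0 i = 0 -> X a i = 0.
  rewrite dE => sum0; apply/eqP; rewrite -sqrf_eq0; apply/eqP.
  by apply: (psumr_eq0P _ sum0) => // b _; rewrite sqr_ge0.
pose I := [pred i | d 0 i != 0].
pose f : 'I_#|I| -> 'I_n := enum_val.
have s_gt0 k : 0 < Num.sqrt (d 0 (f k)).
  by rewrite sqrtr_gt0 lt0r d_ge0 andbT; exact: (enum_valP k).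
exists #|I|, (\matrix_(k, a) (X a (f k) / Num.sqrt (d 0 (f k)))),
  (rowsub f W), (\row_k Num.sqrt (d 0 (f k))); split.
- by move=> k; rewrite mxE ltW.
- apply/matrixP => k l; rewrite mxE [RHS]mxE.
  under eq_bigr => a _ do rewrite !mxE mulrACA -invfM.
  rewrite -mulr_suml XXE (inj_eq enum_val_inj).
  case: eqP => [<-|_]; last by rewrite mul0r.
  by rewrite -expr2 sqr_sqrtr // divff //; exact: (enum_valP k).
- apply/matrixP => k l; have /matrixP/(_ (f k) (f l)) := WW.
  rewrite !mxE (inj_eq enum_val_inj) => <-.
  by apply: eq_bigr => j _; rewrite !mxE.
(* In the expansion of [X *m W], the indices outside [I] contribute nothing because their columns of
   [X] vanish. *)
- have {1}-> : M = X *m W by rewrite defX -mulmxA (mulmx1C WW) mulmx1.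
  apply/matrixP => a b; rewrite mul_mx_diag !mxE.
  rewrite (bigID I) /= [X in _ + X]big1 ?addr0; last first.
    by move=> i /negPn/eqP/X0->; rewrite mul0r.
  rewrite (big_enum_val (A := I)) /=; apply: eq_bigr => k _.
  by rewrite !mxE divfK // gt_eqF.
rewrite (nuclear_norm_diag WW Wd) (bigID I) /=.
rewrite [X in _ + X]big1 ?addr0; last first.
  by move=> i /negPn/eqP->; rewrite sqrtr0.
by rewrite (big_enum_val (A := I)) /=; apply: eq_bigr => k _; rewrite mxE.
Qed.

(** * Frobenius norms and the variational formula for the nuclear norm *)

Lemma sum_sqr_ge0 (R : realDomainType) p n (F : 'I_p -> 'I_n -> R) :
  0 <= \sum_i \sum_j F i j ^+ 2.
Proof. by do 2 (apply: sumr_ge0 => ? _); exact: sqr_ge0. Qed.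

Lemma frob_sqr (R : realType) p n (M : 'M[R]_(p, n)) :
  frob M ^+ 2 = \sum_i \sum_j M i j ^+ 2.
Proof. by rewrite sqr_sqrtr // sum_sqr_ge0. Qed.

Lemma frob_trace (R : realType) p n (M : 'M[R]_(p, n)) :
  frob M ^+ 2 = \tr (M *m M^T).
Proof.
rewrite frob_sqr; apply: eq_bigr => i _; rewrite mxE.
by apply: eq_bigr => j _; rewrite mxE.
Qed.

(** By Pythagoras, the gap between the two sides is the squared norm of [A - U^T U A], the part of
    [A] orthogonal to the rows of [U]. *)
Lemma bessel_frob (R : realType) r p n (U : 'M[R]_(r, p)) (A : 'M[R]_(p, n)) :
  U *m U^T = 1%:M -> frob (U *m A) ^+ 2 <= frob A ^+ 2.
Proof.
move=> UU; set W := U *m A; rewrite -subr_ge0.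
suff -> : frob A ^+ 2 - frob W ^+ 2 = frob (A - U^T *m W) ^+ 2.
  by rewrite sqr_ge0.
have DT : (A - U^T *m W)^T = A^T - W^T *m U.
  by rewrite linearB /= trmx_mul trmxK.
rewrite !frob_trace !(mxtrace_mulC _ (_^T)) DT mulmxBl !mulmxBr.
rewrite (mulmxA A^T) -trmx_mul -(mulmxA W^T U A) -/W.
by rewrite -(mulmxA W^T U) (mulmxA U) UU mul1mx subrr subr0 linearB.
Qed.

Lemma nuclear_norm_mul_le (R : realType) r p n (A : 'M[R]_(p, r))
    (B : 'M[R]_(n, r)) :
  nuclear_norm (A *m B^T) <= (frob A ^+ 2 + frob B ^+ 2) / 2%:R.
Proof.
have [k [U [V [s [s0 UU VV defM ->]]]]] := compact_svd (A *m B^T).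
have -> : \sum_i s 0 i = \tr ((U *m A) *m (V *m B)^T).
  rewrite trmx_mul !mulmxA -(mulmxA U A) defM !mulmxA UU mul1mx -mulmxA VV.
  by rewrite mulmx1 mxtrace_diag.
rewrite ler_pdivlMr ?ltr0n // mulr_natr.
apply: le_trans (lerD (bessel_frob A UU) (bessel_frob B VV)).
set X := U *m A; set Z := V *m B.
rewrite !frob_sqr -big_split /= /mxtrace -sumrMnl.
apply: ler_sum => i _; rewrite -big_split /= mxE -sumrMnl.
(* Entrywise, [2 x z <= x^2 + z^2]. *)
apply: ler_sum => j _; rewrite [Z^T _ _]mxE -subr_ge0.
by rewrite addrAC -sqrrB sqr_ge0.
Qed.

Lemma nuclear_norm_factor (R : realType) p n (M : 'M[R]_(p, n)) :
  exists r (A : 'M[R]_(p, r)) (B : 'M[R]_(n, r)),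
    [/\ (r <= minn p n)%N, M = A *m B^T, frob A ^+ 2 = nuclear_norm M
      & frob B ^+ 2 = nuclear_norm M].
Proof.
have [r [U [V [s [s0 UU VV defM ->]]]]] := compact_svd M.
pose D := diag_mx (\row_i Num.sqrt (s 0 i)).
have DT : D^T = D by exact: tr_diag_mx.
have DD : D *m D = diag_mx s.
  rewrite mul_diag_mx; apply/matrixP => i j; rewrite !mxE.
  by case: eqP => [_|_]; rewrite ?mulr0 // !mulr1n -expr2 sqr_sqrtr.
have frobD q (W : 'M[R]_(r, q)) : W *m W^T = 1%:M ->
    frob (W^T *m D) ^+ 2 = \sum_i s 0 i.
  move=> WW; rewrite frob_trace trmx_mul trmxK DT mulmxA -(mulmxA _ D D) DD.
  by rewrite mxtrace_mulC mulmxA WW mul1mx mxtrace_diag.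
exists r, (U^T *m D), (V^T *m D); split; rewrite ?frobD //.
  by rewrite leq_min !(leq_orthonormal_rows UU, leq_orthonormal_rows VV).
by rewrite trmx_mul trmxK DT mulmxA -(mulmxA _ D D) DD.
Qed.

(** * Comparison of minimization problems *)

(** The factor [c] is [1/|O|] when the estimator minimizes a plain sum of squares, and 1 in the
    penalized cases (i) and (v), where it carries the same normalization as [Q]. *)
Lemma eq_argmin_image (R : realType) (X X' Z : Type) (C : set X) (C' : set X')
    (f : X -> R) (f' : X' -> R) (h : X -> Z) (h' : X' -> Z) (c : R) : 0 < c ->
  (forall x, C x -> exists y, [/\ C' y, c * f' y <= f x & h' y = h x]) ->
  (forall y, C' y -> exists x, [/\ C x, f x <= c * f' y & h x = h' y]) ->
  h @` argmin C f = h' @` argmin C' f'.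
Proof.
move=> c0 toX' toX; apply/seteqP; split => z /= [x [Cx x_min] <-].
  have [y [C'y fy hy]] := toX' x Cx; exists y => //; split=> // y' C'y'.
  have [x' [Cx' fx' _]] := toX y' C'y'.
  rewrite -(ler_pM2l c0); apply: le_trans fx'.
  exact: le_trans fy (x_min _ Cx').
have [y [Cy fy hy]] := toX x Cx; exists y => //; split=> // y' Cy'.
have [x' [C'x' fx' _]] := toX' y' Cy'.
by apply: le_trans fy _; apply: le_trans fx'; rewrite ler_pM2l // x_min.
Qed.

(** * Residuals on the observed entries *)

Section Residuals.
Variables (R : realType) (n m : nat).
Implicit Types M Y : 'M[R]_(n + 1, m + 1).

Lemma residualE Y r (A : 'M[R]_(n + 1, r)) (B : 'M[R]_(m + 1, r)) g d i t :
  (Y - A *m B^T - g *m (ones R (m + 1))^T - ones R (n + 1) *m d^T) i t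
  = Y i t - \sum_k A i k * B t k - g i 0 - d t 0.
Proof.
rewrite !mxE !big_ord1 !mxE mulr1 mul1r; congr (_ - _ - _ - _).
by apply: eq_bigr => k _; rewrite mxE.
Qed.

Lemma imputedE r (A : 'M[R]_(n + 1, r)) (B : 'M[R]_(m + 1, r)) g d :
  imputed (Factors A B g d)
  = \sum_k A (last_ord n) k * B (last_ord m) k
    + g (last_ord n) 0 + d (last_ord m) 0.
Proof.
rewrite /imputed /twoway !mxE !big_ord1 !mxE mulr1 mul1r; congr (_ + _ + _).
by apply: eq_bigr => k _; rewrite mxE.
Qed.

Lemma frob_proj M : frob (proj (observed n m) M) ^+ 2 =
  \sum_(it in observed n m) M it.1 it.2 ^+ 2.
Proof.
rewrite frob_sqr pair_big [RHS]big_mkcond /=; apply: eq_bigr => -[i t] _.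
by rewrite mxE; case: ifP => // _; rewrite expr0n.
Qed.

(** The three sums are the contributions of the blocks of [Y0], [y1] and [y2]; the missing corner is
    projected to 0. *)
Lemma frob_proj_blocks M : frob (proj (observed n m) M) ^+ 2 =
  \sum_(i < n) \sum_(t < m) M (lshift 1 i) (lshift 1 t) ^+ 2
  + \sum_(i < n) M (lshift 1 i) (last_ord m) ^+ 2
  + \sum_(t < m) M (last_ord n) (lshift 1 t) ^+ 2.
Proof.
have lrF (k : nat) (i : 'I_k) : (lshift 1 i == last_ord k) = false.
  by rewrite /last_ord eq_lrshift.
rewrite frob_sqr big_split_ord big_ord1 big_split_ord big_ord1 /=.
rewrite [proj _ _ (rshift n ord0) (rshift m ord0)]mxE !inE eqxx /=.
rewrite expr0n addr0 -big_split /=.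
congr (_ + _).
  apply: eq_bigr => i _; rewrite big_split_ord big_ord1 /=; congr (_ + _).
    by apply: eq_bigr => t _; rewrite mxE !inE xpair_eqE !lrF.
  by rewrite mxE !inE xpair_eqE !lrF.
by apply: eq_bigr => t _; rewrite mxE !inE xpair_eqE !lrF andbF.
Qed.

Lemma observed_gt0 : (0 < n)%N -> 0 < (#|observed n m|%:R : R)^-1.
Proof.
move=> n_gt0; rewrite invr_gt0 ltr0n; apply/card_gt0P.
exists (lshift 1 (Ordinal n_gt0), last_ord m).
by rewrite !inE xpair_eqE /last_ord eq_lrshift.
Qed.

End Residuals.

(** * The six estimators as restricted or regularized factor models *)

Section Estimators.
Variables (R : realType) (n m : nat).
Local Notation N := (n + 1)%N.
Local Notation T := (m + 1)%N.
Local Notation iN := (last_ord n).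
Local Notation iT := (last_ord m).
Hypothesis n_gt0 : (0 < n)%N.
Implicit Type Y : 'M[R]_(N, T).

(** [Q] sees [A] and [B] only through [A B^T], so the fit terms cancel and only the two penalties
    are compared, by the variational formula. *)
Lemma nuclear_norm_mc_factored (lambda : R) Y : 0 < lambda ->
  [set (fA p *m (fB p)^T, fgamma p, fdelta p) | p in
     argmin [set p : factors R N T | (frank p <= minn N T)%N]
            (fun p => Q Y p + lambda / 2%:R * frob (fA p) ^+ 2
                            + lambda / 2%:R * frob (fB p) ^+ 2)]
  = nuclear_norm_mc lambda Y.
Proof.
move=> l0; rewrite -[RHS]image_id /nuclear_norm_mc.
apply: (eq_argmin_image (c := 1)) => //.
  move=> [r A B g d] _; exists (A *m B^T, g, d); split=> //=.
  rewrite mul1r /Q /= -[leRHS]addrA lerD2l -mulrDr -mulrA ler_pM2l // mulrC.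
  exact: nuclear_norm_mul_le.
move=> [[L g] d] _.
have [r [A [B [r_le defL frobA frobB]]]] := nuclear_norm_factor L.
exists (Factors A B g d); split=> //=; last by rewrite -defL.
rewrite mul1r /Q /= -defL frobA frobB -[leLHS]addrA lerD2l -mulrDr.
by rewrite -mulr2n -(mulr_natl (nuclear_norm L)) mulrA divfK ?pnatr_eq0.
Qed.

Lemma horizontal_regression_factored Y :
  @imputed R n m @`
    argmin [set p | exists (A : 'M[R]_(N, m)) (B : 'M[R]_(T, m))
                           (gamma : 'cV[R]_N) (delta : 'cV[R]_T),
              [/\ p = Factors A B gamma delta,
                  A = lsubmx Y,
                  gamma = 0
                & forall t : 'I_m, delta (lshift 1 t) 0 = 0]]
           (Q Y)
  = horizontal_regression Y.
Proof.
apply: (eq_argmin_image (observed_gt0 R m n_gt0)) => [p|[b0 b] _].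
  move=> [A [B [g [d [-> -> -> d0]]]]].
  (* The last row of [B] holds the slopes and the last entry of [d] the intercept. Dropping the
     squared residuals outside the last column can only lower the objective. *)
  exists (d iT 0, \col_s B iT s); split=> //=.
    rewrite /Q /= ler_pM2l ?observed_gt0 // frob_proj_blocks.
    rewrite [leRHS]addrAC -[leLHS]add0r lerD //.
      by rewrite addr_ge0 ?sum_sqr_ge0 // sumr_ge0 // => i _; rewrite sqr_ge0.
    apply: ler_sum => i _; rewrite residualE mxE subr0 addrAC.
    rewrite le_eqVlt; apply/orP; left; apply/eqP.
    by congr ((_ - _ - _) ^+ 2); apply: eq_bigr => s _; rewrite !mxE mulrC.
  rewrite imputedE mxE addr0 addrC; congr (_ + _).
  by apply: eq_bigr => s _; rewrite !mxE mulrC.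
(* The identity block reproduces the first [m] columns of [Y] exactly, last row included. *)
pose B := col_mx 1%:M b^T; pose d : 'cV[R]_T := col_mx 0 b0%:M.
have BE s : B iT s = b s 0 by rewrite col_mxEd mxE.
have dE : d iT 0 = b0 by rewrite col_mxEd mxE.
exists (Factors (lsubmx Y) B 0 d); split.
- exists (lsubmx Y), B, 0, d; split=> // t.
  by rewrite col_mxEu mxE.
- rewrite /Q /= ler_pM2l ?observed_gt0 // frob_proj_blocks.
  rewrite big1 ?add0r => [|i _]; last first.
    rewrite big1 // => t _; rewrite residualE (bigD1 t) //= big1 => [|s st].
      by rewrite !col_mxEu !mxE eqxx /=; ring.
    by rewrite col_mxEu !mxE eq_sym (negPf st) mulr0.
  rewrite [X in _ + X]big1 ?addr0 => [|t _]; last first.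
    rewrite residualE (bigD1 t) //= big1 => [|s st].
      by rewrite !col_mxEu !mxE eqxx /=; ring.
    by rewrite col_mxEu !mxE eq_sym (negPf st) mulr0.
  apply: ler_sum => i _; rewrite residualE mxE subr0 dE addrAC.
  rewrite le_eqVlt; apply/orP; left; apply/eqP.
  by congr ((_ - _ - _) ^+ 2); apply: eq_bigr => s _; rewrite BE mxE mulrC.
rewrite imputedE dE mxE addr0 addrC; congr (_ + _).
by apply: eq_bigr => s _; rewrite BE mxE mulrC.
Qed.

Lemma imputed_vertical Y (A : 'M[R]_(N, n)) (g : 'cV[R]_N) :
  imputed (Factors A (usubmx Y)^T g 0)
  = vertical_imputed Y (g iN 0, \col_i A iN i).
Proof.
rewrite imputedE mxE addr0 addrC; congr (_ + _).
by apply: eq_bigr => i _; rewrite !mxE.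
Qed.

(** The residuals of the last row depend only on the last row of [A] and the last entry of [g]; all
    other rows add squares. *)
Lemma vertical_sse_le Y (A : 'M[R]_(N, n)) (g : 'cV[R]_N) :
  #|observed n m|%:R^-1 * vertical_sse Y (g iN 0, \col_i A iN i)
  <= Q Y (Factors A (usubmx Y)^T g 0).
Proof.
rewrite /Q /= ler_pM2l ?observed_gt0 // frob_proj_blocks.
rewrite -[leLHS]add0r lerD //.
  by rewrite addr_ge0 ?sum_sqr_ge0 // sumr_ge0 // => i _; rewrite sqr_ge0.
apply: ler_sum => t _; rewrite residualE [(0 : 'cV_T) _ _]mxE subr0 addrAC.
rewrite le_eqVlt; apply/orP; left; apply/eqP.
by congr ((_ - _ - _) ^+ 2); apply: eq_bigr => i _; rewrite !mxE.
Qed.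

(** Equality case of [vertical_sse_le]: the identity block fits the first [n] rows of [Y] exactly,
    leaving the regression in the last row. *)
Definition vertical_factors Y (c : R * 'cV[R]_n) : factors R N T :=
  Factors (col_mx 1%:M c.2^T) (usubmx Y)^T (col_mx 0 c.1%:M) 0.

Lemma Q_vertical_factors Y c :
  Q Y (vertical_factors Y c) = #|observed n m|%:R^-1 * vertical_sse Y c.
Proof.
congr (_ * _); rewrite frob_proj_blocks.
set p := vertical_factors Y c.
have exact_fit i t : (Y - fA p *m (fB p)^T - fgamma p *m (ones R T)^T
    - ones R N *m (fdelta p)^T) (lshift 1 i) t = 0.
  rewrite residualE (bigD1 i) //= big1 => [|s si].
    by rewrite !col_mxEu !mxE eqxx /=; ring.
  by rewrite col_mxEu mxE eq_sym (negPf si) mul0r.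
rewrite big1 => [|i _]; last first.
  by rewrite big1 // => t _; rewrite exact_fit expr0n.
rewrite big1 => [|i _]; last by rewrite exact_fit expr0n.
rewrite !add0r; apply: eq_bigr => t _.
rewrite residualE [fdelta _ _ _]mxE subr0 addrAC.
rewrite !col_mxEd mxE eqxx mulr1n; congr ((_ - _ - _) ^+ 2).
by apply: eq_bigr => i _; rewrite col_mxEd !mxE.
Qed.

Lemma imputed_vertical_factors Y c :
  imputed (vertical_factors Y c) = vertical_imputed Y c.
Proof.
rewrite imputed_vertical col_mxEd mxE eqxx mulr1n; case: c => c0 c /=.
by congr (vertical_imputed _ (_, _)); apply/colP => i; rewrite mxE col_mxEd mxE.
Qed.

Definition vertical_constraint Y : set (factors R N T) :=
  [set p | exists (A : 'M[R]_(N, n)) (B : 'M[R]_(T, n))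
                  (gamma : 'cV[R]_N) (delta : 'cV[R]_T),
     [/\ p = Factors A B gamma delta, B = (usubmx Y)^T,
         forall i : 'I_n, gamma (lshift 1 i) 0 = 0 & delta = 0]].

Lemma vertical_factors_constraint Y c :
  vertical_constraint Y (vertical_factors Y c).
Proof.
exists (col_mx 1%:M c.2^T), (usubmx Y)^T, (col_mx 0 c.1%:M), 0.
by split=> // i; rewrite col_mxEu mxE.
Qed.

Lemma vertical_regression_factored Y :
  @imputed R n m @` argmin (vertical_constraint Y) (Q Y)
  = vertical_regression Y.
Proof.
apply: (eq_argmin_image (observed_gt0 R m n_gt0)) => [p|c _].
  move=> [A [_ [g [_ [-> -> _ ->]]]]]; exists (g iN 0, \col_i A iN i).
  by rewrite vertical_sse_le imputed_vertical.
exists (vertical_factors Y c).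
rewrite Q_vertical_factors imputed_vertical_factors.
by split=> //; exact: vertical_factors_constraint.
Qed.

Lemma synthetic_control_factored Y :
  @imputed R n m @`
    argmin [set p | exists (A : 'M[R]_(N, n)) (B : 'M[R]_(T, n))
                           (gamma : 'cV[R]_N) (delta : 'cV[R]_T),
              [/\ p = Factors A B gamma delta,
                  B = (usubmx Y)^T,
                  delta = 0 /\ gamma = 0,
                  forall i : 'I_n, 0 <= A (last_ord n) i
                & \sum_(i < n) A (last_ord n) i = 1]]
           (Q Y)
  = synthetic_control Y.
Proof.
apply: (eq_argmin_image (observed_gt0 R m n_gt0)) => [p|c [c0 c_ge0 c_sum]].
  move=> [A [_ [g [_ [-> -> [-> ->] A_ge0 A_sum]]]]].
  exists ((0 : 'cV_N) iN 0, \col_i A iN i).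
  rewrite vertical_sse_le imputed_vertical; split=> //; split=> /=.
  - by rewrite mxE.
  - by move=> i; rewrite mxE.
  - by rewrite -A_sum; apply: eq_bigr => i _; rewrite mxE.
exists (vertical_factors Y c).
rewrite Q_vertical_factors imputed_vertical_factors.
have last_rowE i : col_mx 1%:M c.2^T iN i = c.2 i 0 by rewrite col_mxEd mxE.
split=> //; exists (col_mx 1%:M c.2^T), (usubmx Y)^T, 0, 0; split=> //.
(* The zero intercept turns the unit effects of [vertical_factors] into [gamma = 0]. *)
- by rewrite /vertical_factors c0 raddf0 col_mx0.
- by move=> i; rewrite last_rowE.
- by apply: etrans c_sum; apply: eq_bigr => i _; rewrite last_rowE.
Qed.

(** The penalty reads only the last row of [A], which is the weight vector in both directions of the
    match, so it cancels from the comparison of objectives. *)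
Lemma elastic_net_factored (lambda alpha : R) Y :
  @imputed R n m @`
    argmin (vertical_constraint Y)
           (fun p => Q Y p
              + lambda * ((1 - alpha) / 2%:R * frob (last_row p) ^+ 2
                          + alpha * l1norm (last_row p)))
  = elastic_net lambda alpha Y.
Proof.
have penaltyE (v : 'cV[R]_n) :
    (1 - alpha) / 2%:R * frob v ^+ 2 + alpha * l1norm v
    = (1 - alpha) / 2%:R * (\sum_(i < n) v i 0 ^+ 2)
      + alpha * (\sum_(i < n) `|v i 0|).
  rewrite frob_sqr; congr (_ * _ + _).
  by apply: eq_bigr => i _; rewrite big_ord1.
apply: (eq_argmin_image ltr01) => [p|c _].
  move=> [A [_ [g [_ [-> -> _ ->]]]]]; exists (g iN 0, \col_i A iN i).
  rewrite imputed_vertical mul1r; split=> //=.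
  have -> : last_row (Factors A (usubmx Y)^T g 0) = \col_i A iN i.
    by apply/colP => i; rewrite !mxE.
  by rewrite penaltyE lerD2r vertical_sse_le.
exists (vertical_factors Y c).
rewrite Q_vertical_factors imputed_vertical_factors.
split=> //; first exact: vertical_factors_constraint.
have -> : last_row (vertical_factors Y c) = c.2.
  by rewrite /last_row /= col_mxKd trmxK.
by rewrite mul1r penaltyE.
Qed.

Lemma difference_in_differences_factored Y :
  @imputed R n m @` argmin [set p | frank p = 0%N] (Q Y)
  = difference_in_differences Y.
Proof.
have rank0E (A : 'M[R]_(N, 0)) (B : 'M[R]_(T, 0))
    (g : 'cV[R]_N) (d : 'cV[R]_T) :
    Q Y (Factors A B g d) = #|observed n m|%:R^-1 *
      (\sum_(it in observed n m) (Y it.1 it.2 - g it.1 0 - d it.2 0) ^+ 2)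
    /\ imputed (Factors A B g d) = g iN 0 + d iT 0.
  rewrite imputedE big_ord0 add0r; split=> //.
  congr (_ * _); rewrite frob_proj; apply: eq_bigr => it _.
  by rewrite residualE big_ord0 subr0.
apply: (eq_argmin_image (observed_gt0 R m n_gt0)) =>
    [[r A B g d] /= r0|[g d] _].
  (* The types of [A] and [B] mention the rank, so they are generalized before it is replaced by
     0. *)
  move: A B; rewrite r0 => A B; exists (g, d).
  by have [-> ->] := rank0E A B g d.
exists (Factors (0 : 'M_(N, 0)) (0 : 'M_(T, 0)) g d).
by have [-> ->] := rank0E 0 0 g d.
Qed.

End Estimators.

Theorem theorem1 (R : realType) (n m : nat)
    (hN : (2 <= n + 1)%N) (hT : (2 <= m + 1)%N)
    (Y : 'M[R]_(n + 1, m + 1))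
    (Y0 : 'M[R]_(n, m)) (y1 : 'cV[R]_n) (y2 : 'cV[R]_m) (missing : R)
    (hY : Y = block_mx Y0 y1 y2^T missing%:M) :
  (* (i) nuclear norm matrix completion *)
  (forall lambda : R, 0 < lambda ->
     [set (fA p *m (fB p)^T, fgamma p, fdelta p) | p in
        argmin [set p : factors R (n + 1) (m + 1) |
                  (frank p <= minn (n + 1) (m + 1))%N]
               (fun p => Q Y p + lambda / 2%:R * frob (fA p) ^+ 2
                               + lambda / 2%:R * frob (fB p) ^+ 2)]
     = nuclear_norm_mc lambda Y)
  /\
  (* (ii) horizontal regression *)
  ((n + 1 > m + 1)%N ->
     @imputed R n m @`
        argmin [set p | exists (A : 'M[R]_(n + 1, m)) (B : 'M[R]_(m + 1, m))
                               (gamma : 'cV[R]_(n + 1)) (delta : 'cV[R]_(m + 1)),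
                  [/\ p = Factors A B gamma delta,
                      A = col_mx Y0 y2^T,
                      gamma = 0
                    & forall t : 'I_m, delta (lshift 1 t) 0 = 0]]
               (Q Y)
     = horizontal_regression Y)
  /\
  (* (iii) vertical regression *)
  ((m + 1 > n + 1)%N ->
     @imputed R n m @`
        argmin [set p | exists (A : 'M[R]_(n + 1, n)) (B : 'M[R]_(m + 1, n))
                               (gamma : 'cV[R]_(n + 1)) (delta : 'cV[R]_(m + 1)),
                  [/\ p = Factors A B gamma delta,
                      B = col_mx Y0^T y1^T,
                      forall i : 'I_n, gamma (lshift 1 i) 0 = 0
                    & delta = 0]]
               (Q Y)
     = vertical_regression Y)
  /\
  (* (iv) synthetic control *)
  (@imputed R n m @`
      argmin [set p | exists (A : 'M[R]_(n + 1, n)) (B : 'M[R]_(m + 1, n))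
                             (gamma : 'cV[R]_(n + 1)) (delta : 'cV[R]_(m + 1)),
                [/\ p = Factors A B gamma delta,
                    B = col_mx Y0^T y1^T,
                    delta = 0 /\ gamma = 0,
                    forall i : 'I_n, 0 <= A (last_ord n) i
                  & \sum_(i < n) A (last_ord n) i = 1]]
             (Q Y)
   = synthetic_control Y)
  /\
  (* (v) vertical regression with elastic net *)
  (forall lambda alpha : R, 0 <= lambda -> 0 <= alpha <= 1 ->
     @imputed R n m @`
        argmin [set p | exists (A : 'M[R]_(n + 1, n)) (B : 'M[R]_(m + 1, n))
                               (gamma : 'cV[R]_(n + 1)) (delta : 'cV[R]_(m + 1)),
                  [/\ p = Factors A B gamma delta,
                      B = col_mx Y0^T y1^T,
                      forall i : 'I_n, gamma (lshift 1 i) 0 = 0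
                    & delta = 0]]
               (fun p => Q Y p
                  + lambda * ((1 - alpha) / 2%:R * frob (last_row p) ^+ 2
                              + alpha * l1norm (last_row p)))
     = elastic_net lambda alpha Y)
  /\
  (* (vi) difference-in-differences *)
  (@imputed R n m @` argmin [set p | frank p = 0%N] (Q Y)
   = difference_in_differences Y).
Proof.
have n_gt0 : (0 < n)%N by rewrite addn1 in hN.
(* The prescribed factors are the observed columns of [Y] and the transpose of its observed rows. *)
have -> : col_mx Y0 y2^T = lsubmx Y by rewrite hY block_mxEh row_mxKl.
have -> : col_mx Y0^T y1^T = (usubmx Y)^T.
  by rewrite hY /block_mx col_mxKu tr_row_mx.
split; first by move=> lambda; exact: nuclear_norm_mc_factored.
split; first by move=> _; exact: horizontal_regression_factored.
split; first by move=> _; exact: vertical_regression_factored.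
split; first exact: synthetic_control_factored.
split; first by move=> lambda alpha _ _; exact: elastic_net_factored.
exact: difference_in_differences_factored.
Qed.
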